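(* The near Goldbach graph $G(n)$ is connected for all $n\in\mathbb{N}$ if and only if every even integer greater than $2$ can be written as a sum of two distinct positive integers each of which is an odd prime or $1$.
   Context: $\mathbb{N}$ denotes the positive integers. For $n\in\mathbb{N}$, the (finite) near Goldbach graph $G(n)$ is the simple undirected graph with vertex set $\{2,4,6,\ldots,2n\}$ in which two distinct vertices $a,b$ are adjacent if and only if both $\frac{a+b}{2}$ and $\frac{|a-b|}{2}$ belong to $O=\{q : q \text{ prime},\ 2<q<2n\}\cup\{1\}$. *)

(* Defs.v *)
From mathcomp Require Import all_boot all_order all_algebra.
Set Implicit Arguments.
Unset Strict Implicit.
Unset Printing Implicit Defensive.

Definition odd_prime_or_one (q : nat) : bool := (prime q && odd q) || (q == 1).

Definition goldbach_O (n : nat) : pred nat :=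
  [pred q | (prime q && (2 < q < 2 * n)) || (q == 1)].

Definition goldbach_vertex (n : nat) : finType :=
  {a : 'I_(2 * n).+1 | (0 < a) && ~~ odd a}.

(* Vertices are even, so both divisions by 2 are exact; `|a - b|%N is the
   absolute difference (of ssrint), not truncated subtraction. *)
Definition near_goldbach (n : nat) : rel (goldbach_vertex n) :=
  fun u v =>
    let a : nat := val (val u) in
    let b : nat := val (val v) in
    [&& a != b, (a + b) %/ 2 \in goldbach_O n
      & `|a - b|%N %/ 2 \in goldbach_O n].

Lemma near_goldbach_irrefl (n : nat) : irreflexive (@near_goldbach n).
Proof. by move=> u; rewrite /near_goldbach eqxx. Qed.

Lemma near_goldbach_sym (n : nat) : symmetric (@near_goldbach n).
Proof.
by move=> u v; rewrite /near_goldbach eq_sym addnC distnC.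
Qed.

(* For symmetric e, connect e x y says that some walk joins x to y. *)
Definition connected_graph (T : finType) (e : rel T) : Prop :=
  0 < #|T| /\ forall x y : T, connect e x y.

(* Main.v *)
Require Import Defs.
From mathcomp Require Import all_boot all_order all_algebra.
From mathcomp Require Import zify.

(** An edge of the graph joining a larger vertex [a] to a smaller vertex [b] is
    the same thing as a decomposition of [a] as a sum of distinct odd primes or
    ones: the half-sum [p] and the half-difference [q] of the ends satisfy
    [a = p + q] and [b = p - q], with [q < p] because [b] is positive.

    If the graph on [2, 4, ..., 2n] is connected and [n > 1], its largest
    vertex [2n] has a neighbour, which is necessarily smaller
    ([smaller_neighbour_split]), so [2n] splits as required.  Conversely, if
    every even number above 2 splits, then every vertex [p + q] other than 2 has
    the smaller neighbour [p - q] ([split_smaller_neighbour]); descending along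
    such neighbours joins every vertex to 2. *)

Lemma odd_prime_or_one_odd (q : nat) : odd_prime_or_one q -> odd q.
Proof. by case/orP=> [/andP[]|/eqP->]. Qed.

Lemma goldbach_O_odd_prime_or_one (n q : nat) :
  q \in goldbach_O n -> odd_prime_or_one q.
Proof.
rewrite inE /odd_prime_or_one => /orP[/andP[pr_q /andP[q_gt2 _]]|->]; last by rewrite orbT.
by have [q2|->] := even_prime pr_q; [rewrite q2 in q_gt2 | rewrite pr_q].
Qed.

Lemma odd_prime_or_one_goldbach_O (n q : nat) :
  odd_prime_or_one q -> q < 2 * n -> q \in goldbach_O n.
Proof.
rewrite inE => /orP[/andP[pr_q odd_q]|->]; last by rewrite orbT.
by move=> ->; rewrite pr_q odd_prime_gt2.
Qed.

Lemma goldbach_vertex_bounds (n : nat) (u : goldbach_vertex n) :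
  [/\ 0 < val (val u), ~~ odd (val (val u)) & val (val u) <= 2 * n].
Proof.
have /andP[u_gt0 even_u] := valP u.
by split=> //; rewrite -ltnS; apply: ltn_ord.
Qed.

Lemma goldbach_vertex_of (n b : nat) :
  0 < b -> ~~ odd b -> b <= 2 * n ->
  exists v : goldbach_vertex n, val (val v) = b.
Proof.
move=> b_gt0 even_b le_b.
have lt_b : b < (2 * n).+1 by [].
have Pb : (0 < Ordinal lt_b) && ~~ odd (Ordinal lt_b) by rewrite b_gt0.
by exists (Sub (Ordinal lt_b) Pb).
Qed.

(** The summands are the half-sum and half-difference of the ends: they add up
    to the larger end, and differ because their difference is the smaller end,
    which is positive. *)
Lemma smaller_neighbour_split (n : nat) (u v : goldbach_vertex n) :
  near_goldbach u v -> val (val v) < val (val u) ->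
  exists p q : nat,
    [/\ p != q, odd_prime_or_one p, odd_prime_or_one q & val (val u) = p + q].
Proof.
have [u_gt0 even_u _] := goldbach_vertex_bounds _ u.
have [v_gt0 even_v _] := goldbach_vertex_bounds _ v.
rewrite /near_goldbach; move: (val (val u)) (val (val v)) u_gt0 even_u v_gt0 even_v.
move=> a b a_gt0 even_a b_gt0 even_b /and3P[_ Op Oq] lt_ba.
exists ((a + b) %/ 2), (`|a - b|%N %/ 2).
split; [lia | exact: goldbach_O_odd_prime_or_one _ _ Op
            | exact: goldbach_O_odd_prime_or_one _ _ Oq | lia].
Qed.

(** The neighbour is [p - q], whose half-sum and half-difference with [p + q] are
    [p] and [q].  It is a vertex since [p] and [q] are both odd, and the bound
    [p < 2n] required by the edge set holds since [q] is positive and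
    [p + q <= 2n]. *)
Lemma split_smaller_neighbour (n p q : nat) (u : goldbach_vertex n) :
  odd_prime_or_one p -> odd_prime_or_one q -> q < p -> val (val u) = p + q ->
  exists2 v : goldbach_vertex n, near_goldbach u v & val (val v) < val (val u).
Proof.
move=> Pp Pq lt_qp def_u.
have [_ _ u_le] := goldbach_vertex_bounds _ u.
have odd_p := odd_prime_or_one_odd _ Pp.
have odd_q := odd_prime_or_one_odd _ Pq.
have q_gt0 := odd_gt0 odd_q.
have [|||v def_v] := goldbach_vertex_of n (p - q); [lia | lia | lia |].
exists v; last by rewrite def_u def_v; lia.
rewrite /near_goldbach def_u def_v.
have -> : (p + q + (p - q)) %/ 2 = p by lia.
have -> : `|(p + q)%N - (p - q)%N|%N %/ 2 = q by lia.
by apply/and3P; split; [lia | apply: odd_prime_or_one_goldbach_O => //; lia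
                            | apply: odd_prime_or_one_goldbach_O => //; lia].
Qed.

Theorem theorem1p5 :
  (forall n : nat, 0 < n -> connected_graph (@near_goldbach n)) <->
  (forall m : nat, 2 < m -> ~~ odd m ->
     exists p q : nat,
       [/\ p != q, odd_prime_or_one p, odd_prime_or_one q & m = p + q]).
Proof.
split=> [conn m m_gt2 even_m | split_even n n_gt0].
  have [|_ joined] := conn (m %/ 2); first by lia.
  have [|||top def_top] := goldbach_vertex_of (m %/ 2) m; [lia | lia | lia |].
  have [|||two def_two] := goldbach_vertex_of (m %/ 2) 2; [lia | lia | lia |].
  (* A walk from the top vertex to 2 is not empty, so it has a first edge. *)
  have /connectP[[|v s] /= walk def_last] := joined top two.
    by move: def_two; rewrite def_last def_top; lia.
  have /andP[edge _] := walk.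
  rewrite -def_top; apply: (smaller_neighbour_split _ _ _ edge).
  have [_ _ v_le] := goldbach_vertex_bounds _ v.
  have /and3P[neq _ _] := edge.
  by move: neq v_le; rewrite def_top; lia.
have [|||two def_two] := goldbach_vertex_of n 2; [lia | lia | lia |].
have to_two (u : goldbach_vertex n) : connect (@near_goldbach n) u two.
  have [k] := ubnP (val (val u)); elim: k u => // k IHk u lt_uk.
  have [u_gt0 even_u _] := goldbach_vertex_bounds _ u.
  have [u_le2 | u_gt2] := leqP (val (val u)) 2.
    suff -> : u = two by apply: connect0.
    by do 2!apply: val_inj; rewrite def_two; lia.
  have [p [q [neq_pq Pp Pq def_u]]] := split_even _ u_gt2 even_u.
  have [v edge lt_vu] : exists2 v : goldbach_vertex n,
      near_goldbach u v & val (val v) < val (val u).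
    case: (ltngtP q p) neq_pq => // [lt_qp|lt_pq] _.
      exact: split_smaller_neighbour _ _ _ _ Pp Pq lt_qp def_u.
    by apply: split_smaller_neighbour _ _ _ _ Pq Pp lt_pq _; rewrite addnC.
  apply: connect_trans (connect1 edge) (IHk v _).
  exact: leq_trans lt_vu lt_uk.
split=> [|u v]; first by apply/card_gt0P; exists two.
apply: connect_trans (to_two u) _.
by rewrite (sym_connect_sym (@near_goldbach_sym n)) to_two.
Qed.
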